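(* Let $V$ be a finite-dimensional real vector space. The assignment $\iota_{u\cdot v}:=\{\iota_u,\iota_v\}$, for $u,v\in V$, gives a bijection between linear symmetric Poisson structures of the form $(\{\,,\},\nabla^{\mathrm{Euc}})$ on $V^*$ and Jacobi-Jordan algebra structures $\cdot$ on $V$. Under this bijection, linear strong symmetric Poisson structures $(\{\,,\},\nabla^{\mathrm{Euc}})$ on $V^*$ correspond precisely to associative Jacobi-Jordan algebra structures on $V$.
   Context: For $u\in V$, $\iota_u\in C^\infty(V^* )$ denotes the linear function $\iota_u(\zeta)=\zeta(u)$; this identifies $V$ with the space $C^\infty_{\mathrm{lin}}(V^* )$ of linear functions on $V^*$. $\nabla^{\mathrm{Euc}}$ is the Euclidean connection on $V^*$: the connection whose Christoffel symbols vanish in global linear coordinates. A symmetric Poisson bracket on a manifold $M$ is an $\mathbb{R}$-bilinear map $\{\,,\}:C^\infty(M)\times C^\infty(M)\to C^\infty(M)$ with $\{f,g\}=\{g,f\}$ and $\{f,gh\}=\{f,g\}h+g\{f,h\}$. Such brackets correspond bijectively to symmetric bivector fields $\vartheta\in\Gamma(\mathrm{Sym}^2TM)$ via $\{f,g\}=\vartheta(\mathrm{d}f,\mathrm{d}g)$. Put $X_f:=\{f,\cdot\}\in\mathfrak{X}(M)$. For a torsion-free connection $\nabla$ on $M$ and vector fields $X,Y$, put $[X,Y]_s:=\nabla_XY+\nabla_YX$. The pair $(\{\,,\},\nabla)$ is a symmetric Poisson structure if for all $f,g,h\in C^\infty(M)$, $$\{f,\{g,h\}\}+\{g,\{h,f\}\}+\{h,\{f,g\}\}=\mathrm{d}h([X_f,X_g]_s)+\mathrm{d}f([X_g,X_h]_s)+\mathrm{d}g([X_h,X_f]_s)$$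 (equivalently, the symmetric Schouten bracket $[\vartheta,\vartheta]_s$ vanishes), and it is a strong symmetric Poisson structure if $X_{\{f,g\}}=[X_f,X_g]_s$ for all $f,g$. A symmetric Poisson bracket on $C^\infty(V^* )$, or a (strong) symmetric Poisson structure with such a bracket, is linear if $\{C^\infty_{\mathrm{lin}}(V^* ),C^\infty_{\mathrm{lin}}(V^* )\}\subseteq C^\infty_{\mathrm{lin}}(V^* )$. A Jacobi-Jordan algebra structure on $V$ is a bilinear commutative product $\cdot$ on $V$ such that $u\cdot(v\cdot w)+v\cdot(w\cdot u)+w\cdot(u\cdot v)=0$ for all $u,v,w\in V$. *)

(* Defs.v *)
From HB Require Import structures.
From mathcomp Require Import all_boot all_order all_algebra.
From mathcomp Require Import all_classical all_reals all_analysis.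

Set Implicit Arguments.
Unset Strict Implicit.
Unset Printing Implicit Defensive.

Import Order.TTheory GRing.Theory Num.Theory.
Import numFieldNormedType.Exports.

Local Open Scope classical_set_scope.
Local Open Scope ring_scope.

Section SmoothFunctions.
Variables (R : realType) (E : normedModType R).
Implicit Types (f g : E -> R) (k : nat).

(* For finite-dimensional [E] this is the usual notion: [f] is C^(k+1) iff it
   is differentiable and its directional derivatives along fixed vectors are
   C^k. *)
Fixpoint Ck k f : Prop :=
  if k is k'.+1 then
    (forall x, differentiable f x) /\ (forall v, Ck k' ('D_v f))
  else continuous f.

Definition smooth f : Prop := forall k, Ck k f.

Lemma CkW k f : Ck k.+1 f -> Ck k f.
Proof.
elim: k f => [|k IH] f [df Df].
  by move=> x; apply: differentiable_continuous.
by split=> // v; apply/IH/Df.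
Qed.

Lemma Ck_cst k (c : R) : Ck k (cst c).
Proof.
elim: k c => [|k IH] c; first by move=> x; exact: cst_continuous.
split=> [x|v]; first exact: differentiable_cst.
have -> : 'D_v (cst c : E -> R) = cst 0.
  by apply/funext => x; rewrite derive_cst.
exact: IH.
Qed.

Lemma CkD k f g : Ck k f -> Ck k g -> Ck k (f + g).
Proof.
elim: k f g => [|k IH] f g; first move=> cf cg x.
  by apply: continuousD; [exact: cf|exact: cg].
move=> [df Df] [dg Dg]; split=> [x|v]; first exact: differentiableD.
have -> : 'D_v (f + g) = 'D_v f + 'D_v g.
  by apply/funext => x; rewrite deriveD//; exact: diff_derivable.
apply: IH; [exact: Df|exact: Dg].
Qed.

Lemma CkM k f g : Ck k f -> Ck k g -> Ck k (f * g).
Proof.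
elim: k f g => [|k IH] f g; first move=> cf cg x.
  by apply: continuousM; [exact: cf|exact: cg].
move=> cf cg; have [df Df] := cf; have [dg Dg] := cg.
split=> [x|v]; first exact: differentiableM.
have -> : 'D_v (f * g) = f * 'D_v g + g * 'D_v f.
  by apply/funext => x; rewrite deriveM//; exact: diff_derivable.
apply: CkD; apply: IH; [exact: CkW|exact: Dg|exact: CkW|exact: Df].
Qed.

Lemma CkZ k (c : R) f : Ck k f -> Ck k (c *: f).
Proof. by move=> cf; apply: (@CkM k (cst c)) cf; exact: Ck_cst. Qed.

Lemma smooth_derive v f : smooth f -> smooth ('D_v f).
Proof. by move=> sf k; have [_ Df] := sf k.+1; exact: Df. Qed.

Lemma smooth_linear (f : {linear E -> R}) : continuous f -> smooth f.
Proof.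
move=> cf [|k] //; split=> [x|v]; first exact: linear_differentiable.
have -> : 'D_v f = cst (f v); last exact: Ck_cst.
apply/funext => x; rewrite deriveE; last exact: linear_differentiable.
by rewrite diff_lin.
Qed.

Definition smooth_pred : {pred E -> R} := fun f => `[<smooth f>].

Lemma smooth_subring : subring_closed smooth_pred.
Proof.
split=> [|f g /asboolP sf /asboolP sg|f g /asboolP sf /asboolP sg].
- by apply/asboolP => k; exact: Ck_cst.
- apply/asboolP => k; rewrite -(scaleN1r g).
  by apply: CkD => //; exact: CkZ.
- by apply/asboolP => k; exact: CkM.
Qed.

Lemma smooth_scaler : GRing.scaler_closed smooth_pred.
Proof. by move=> c f /asboolP sf; apply/asboolP => k; exact: CkZ. Qed.

HB.instance Definition _ :=
  GRing.isSubringClosed.Build (E -> R) smooth_pred smooth_subring.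
HB.instance Definition _ :=
  GRing.isScaleClosed.Build R (E -> R) smooth_pred smooth_scaler.

Record smoothfun := SmoothFun {
  smoothfun_fun :> E -> R;
  smoothfunP : smoothfun_fun \in smooth_pred }.

HB.instance Definition _ := [isSub for smoothfun_fun].
HB.instance Definition _ := [Choice of smoothfun by <:].
HB.instance Definition _ := [SubChoice_isSubComNzRing of smoothfun by <:].
HB.instance Definition _ := [SubZmodule_isSubLmodule of smoothfun by <:].

End SmoothFunctions.

Arguments smooth_pred {R E}.

Section VectorFields.
Variables (R : realType) (E : normedModType R).
Local Notation Cinf := (smoothfun E).

(* Vector fields as derivations of the algebra of smooth functions. *)
Definition derivation (X : Cinf -> Cinf) : Prop :=
  linear X /\ forall f g, X (f * g) = X f * g + f * X g.

Definition vfield_pred : {pred Cinf -> Cinf} := fun X => `[<derivation X>].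

Lemma vfield_zmod : zmod_closed vfield_pred.
Proof.
split=> [|X Y /asboolP[Xl XM] /asboolP[Yl YM]]; apply/asboolP; split.
- by move=> c f g /=; rewrite scaler0 addr0.
- by move=> f g /=; rewrite mul0r mulr0 addr0.
- move=> c f g; rewrite !fctE Xl Yl scalerBr opprD.
  by rewrite !addrA [in RHS](addrAC _ _ (X g)).
- move=> f g; rewrite !fctE XM YM opprD mulrBl mulrBr.
  by rewrite !addrA [in RHS](addrAC _ _ (f * X g)).
Qed.

HB.instance Definition _ :=
  GRing.isZmodClosed.Build (Cinf -> Cinf) vfield_pred vfield_zmod.

Record vfield := VField {
  vfield_fun :> Cinf -> Cinf;
  vfieldP : vfield_fun \in vfield_pred }.

HB.instance Definition _ := [isSub for vfield_fun].
HB.instance Definition _ := [Choice of vfield by <:].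
HB.instance Definition _ := [SubChoice_isSubZmodule of vfield by <:].

Lemma vfield_scale_subproof (a : Cinf) (X : vfield) :
  (fun f => a * X f) \in vfield_pred.
Proof.
have /asboolP[Xl XM] := vfieldP X; apply/asboolP; split=> [c f g|f g].
  by rewrite Xl mulrDr; congr (_ + _); apply/val_inj/funext => x; exact: mulrCA.
by rewrite XM mulrDr mulrA; congr (_ + _); rewrite mulrCA.
Qed.

Definition vfield_scale a X := VField (vfield_scale_subproof a X).

Lemma vfield_scaleA a b X :
  vfield_scale a (vfield_scale b X) = vfield_scale (a * b) X.
Proof. by apply/val_inj/funext => f; exact: mulrA. Qed.

Lemma vfield_scale1 : left_id 1 vfield_scale.
Proof. by move=> X; apply/val_inj/funext => f; exact: mul1r. Qed.

Lemma vfield_scaleDr : right_distributive vfield_scale +%R.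
Proof. by move=> a X Y; apply/val_inj/funext => f; exact: mulrDr. Qed.

Lemma vfield_scaleDl X : {morph vfield_scale^~ X : a b / a + b}.
Proof. by move=> a b; apply/val_inj/funext => f; exact: mulrDl. Qed.

(* The C^oo-module structure: [(a *: X) f = a * X f]. *)
HB.instance Definition _ := GRing.Zmodule_isLmodule.Build Cinf vfield
  vfield_scaleA vfield_scale1 vfield_scaleDr vfield_scaleDl.

Lemma smooth_partial_subproof (v : E) (f : Cinf) :
  ('D_v f : E -> R) \in smooth_pred.
Proof.
have /asboolP sf := smoothfunP f.
by apply/asboolP; exact: smooth_derive.
Qed.

Definition partial_fun (v : E) (f : Cinf) : Cinf :=
  SmoothFun (smooth_partial_subproof v f).

Lemma smoothfun_derivable (v : E) (f : Cinf) x : derivable f x v.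
Proof.
have /asboolP/(_ 1%N)[df _] := smoothfunP f.
by apply: diff_derivable; exact: df.
Qed.

Lemma partial_subproof v : partial_fun v \in vfield_pred.
Proof.
apply/asboolP; split=> [c f g|f g]; apply/val_inj/funext => x /=.
- rewrite [LHS]deriveD; [|apply: derivableZ|]; try exact: smoothfun_derivable.
  by rewrite deriveZ//; exact: smoothfun_derivable.
- rewrite [LHS]deriveM; try exact: smoothfun_derivable.
  by rewrite addrC; congr (_ + _); exact: mulrC.
Qed.

(* The constant vector field on [E] with value [v]. *)
Definition partial (v : E) : vfield := VField (partial_subproof v).

(* In [connection_linearl], [linear] means linear over smooth functions;
   linearity over [R] in the second argument follows from additivity and the
   Leibniz rule for constant [f]. *)
Record torsion_free_connection (nabla : vfield -> vfield -> vfield) : Prop := {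
  connection_linearl : forall Y, linear (nabla^~ Y);
  connection_additive : forall X, {morph nabla X : Y Z / Y + Z};
  connection_leibniz : forall X Y f,
    nabla X (f *: Y) = X f *: Y + f *: nabla X Y;
  connection_torsion_free : forall X Y f,
    nabla X Y f - nabla Y X f = X (Y f) - Y (X f) }.

Definition sym_bracket nabla (X Y : vfield) : vfield :=
  nabla X Y + nabla Y X.

Record sym_poisson_bracket := SymPoissonBracket {
  spbracket :> Cinf -> Cinf -> Cinf;
  spbracket_linearl : forall g, linear (spbracket^~ g);
  spbracket_linearr : forall f, linear (spbracket f);
  spbracketC : forall f g, spbracket f g = spbracket g f;
  spbracketM : forall f g h,
    spbracket f (g * h) = spbracket f g * h + g * spbracket f h }.

Lemma grad_subproof (B : sym_poisson_bracket) f : B f \in vfield_pred.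
Proof.
by apply/asboolP; split; [exact: spbracket_linearr|exact: spbracketM].
Qed.

(* [X_f = {f, .}]. *)
Definition grad (B : sym_poisson_bracket) (f : Cinf) : vfield :=
  VField (grad_subproof B f).

(* For a vector field [X] and a function [h], [dh(X)] is [X h]. *)
Definition sym_poisson_structure (B : sym_poisson_bracket)
    (nabla : vfield -> vfield -> vfield) : Prop :=
  torsion_free_connection nabla /\
  forall f g h,
    B f (B g h) + B g (B h f) + B h (B f g) =
    sym_bracket nabla (grad B f) (grad B g) h
    + sym_bracket nabla (grad B g) (grad B h) f
    + sym_bracket nabla (grad B h) (grad B f) g.

Definition strong_sym_poisson_structure (B : sym_poisson_bracket)
    (nabla : vfield -> vfield -> vfield) : Prop :=
  torsion_free_connection nabla /\
  forall f g, grad B (B f g) = sym_bracket nabla (grad B f) (grad B g).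

End VectorFields.

Section Dual.
Variables (R : realType) (V : vectType R).

Definition dualspace : Type := 'Hom(V, R^o).
HB.instance Definition _ := Vector.on dualspace.

Local Notation n := (\dim {:V}).
Local Notation e := (vbasis {:V}).

Definition dual_coord (xi : dualspace) : 'rV[R]_n := \row_(k < n) xi e`_k.

Lemma dual_coord_linear : linear dual_coord.
Proof. by move=> c xi zeta; apply/rowP => k; rewrite !mxE !lfunE/= lfunE. Qed.

HB.instance Definition _ :=
  GRing.isLinear.Build R dualspace 'rV[R]_n _ dual_coord dual_coord_linear.

Lemma dual_eval (xi : dualspace) u :
  xi u = \sum_(k < n) coord e k u * dual_coord xi 0 k.
Proof.
rewrite {1}(coord_vbasis (memvf u)) linear_sum; apply: eq_bigr => k _.
by rewrite linearZ/= mxE.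
Qed.

(* Any norm would do: they are all equivalent in finite dimension. *)
Definition dual_norm (xi : dualspace) : R := `|dual_coord xi|.

Lemma dual_normD xi zeta :
  dual_norm (xi + zeta) <= dual_norm xi + dual_norm zeta.
Proof. by rewrite /dual_norm linearD; exact: ler_normD. Qed.

Lemma dual_normZ (c : R) xi : dual_norm (c *: xi) = `|c| * dual_norm xi.
Proof. by rewrite /dual_norm linearZ normrZ. Qed.

Lemma dual_norm_eq0 xi : dual_norm xi = 0 -> xi = 0.
Proof.
move/normr0_eq0 => xi0; apply/lfunP => u.
rewrite dual_eval xi0 lfunE/= big1// => k _.
by rewrite mxE mulr0.
Qed.

HB.instance Definition _ :=
  Lmodule_isNormed.Build R dualspace dual_normD dual_normZ dual_norm_eq0.

Lemma dual_coord_continuous k :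
  continuous (fun xi : dualspace => dual_coord xi 0 k).
Proof.
move=> xi; apply/(@cvgrPdist_lt R R dualspace (nbhs xi) _) => eps eps0.
near=> zeta.
have : `|xi - zeta| < eps.
  by near: zeta; apply/(@nbhs_normP R dualspace); exists eps.
apply: le_lt_trans.
have -> : dual_coord xi 0 k - dual_coord zeta 0 k = dual_coord (xi - zeta) 0 k.
  by rewrite linearB !mxE.
have -> : `|xi - zeta| = mx_norm (dual_coord (xi - zeta)) by [].
rewrite mx_normrE.
exact: (le_bigmax _ (fun ij => `|dual_coord (xi - zeta) ij.1 ij.2|) (0, k)).
Unshelve. all: by end_near. Qed.

Section Iota.
Variable u : V.

Definition iota_fun (xi : dualspace) : R := xi u.

Lemma iota_fun_linear : scalar iota_fun.
Proof. by move=> c xi zeta; rewrite /iota_fun lfunE/= lfunE. Qed.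

HB.instance Definition _ :=
  GRing.isLinear.Build R dualspace R _ iota_fun iota_fun_linear.

Lemma iota_fun_continuous : continuous iota_fun.
Proof.
have -> : iota_fun =
    \sum_(k < n) (fun xi => coord e k u * dual_coord xi 0 k).
  by apply/funext => xi; rewrite fct_sumE; exact: dual_eval.
elim/big_ind: _ => [|f g cf cg|k _] xi; first exact: cst_continuous.
- by apply: continuousD; [exact: cf|exact: cg].
- by apply: continuousM; [exact: cst_continuous|exact: dual_coord_continuous].
Qed.

Lemma iota_subproof : iota_fun \in smooth_pred.
Proof.
by apply/asboolP; apply: smooth_linear; exact: iota_fun_continuous.
Qed.

Definition lin_iota : smoothfun dualspace := SmoothFun iota_subproof.

End Iota.

End Dual.

Section EuclideanConnection.
Variables (R : realType) (V : vectType R).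
Local Notation n := (\dim {:V}).
Local Notation e := (vbasis {:V}).

(* The basis of [dualspace V] dual to [vbasis {:V}]; [partial (dual_basis k)]
   is the coordinate vector field of the linear coordinate [lin_iota e`_k]. *)
Definition dual_basis (k : 'I_n) : dualspace V := linfun (coord e k : V -> R^o).

(* [nabla_X Y = \sum_k X(Y^k) d/dx_k], where [x_k = lin_iota e`_k] are the
   linear coordinates on [dualspace V] and [Y^k = Y x_k] are the components
   of [Y]. *)
Definition euclidean_connection (X Y : vfield (dualspace V)) :
    vfield (dualspace V) :=
  \sum_(k < n) X (Y (lin_iota e`_k)) *: partial (dual_basis k).

Lemma partial_iota (zeta : dualspace V) u :
  partial zeta (lin_iota u) = cst (zeta u) :> (dualspace V -> R).
Proof.
have cu := @iota_fun_continuous R V u.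
have du xi := linear_differentiable (f := iota_fun u) xi cu.
by apply/funext => xi; rewrite /= deriveE// diff_lin.
Qed.

(* Its Christoffel symbols in the coordinates [x_k] vanish. *)
Lemma euclidean_connection_christoffel i j :
  euclidean_connection (partial (dual_basis i)) (partial (dual_basis j)) = 0.
Proof.
apply: big1 => k _.
suff -> : partial (dual_basis i) (partial (dual_basis j) (lin_iota e`_k)) = 0.
  by rewrite scale0r.
apply/val_inj => /=; have /= -> := partial_iota (dual_basis j) e`_k.
by apply/funext => xi; rewrite derive_cst.
Qed.

Definition smooth_lin : set (smoothfun (dualspace V)) :=
  [set f : smoothfun (dualspace V) | scalar f].

Definition linear_bracket (B : sym_poisson_bracket (dualspace V)) : Prop :=
  forall f g, smooth_lin f -> smooth_lin g -> smooth_lin (B f g).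

Definition jacobi_jordan (m : V -> V -> V) : Prop :=
  [/\ forall v, linear (m^~ v), forall u, linear (m u), commutative m &
      forall u v w, m u (m v w) + m v (m w u) + m w (m u v) = 0].

End EuclideanConnection.

(* Main.v *)
(* A derivation of the smooth functions on [V^*] is determined by its values on
   the linear coordinates: by Hadamard's lemma
   [f x = f a + \sum_k (x_k - a_k) g_k x] with
   [g_k x = \int_0^1 d_k f (a + t (x - a)) dt] smooth. The defect
   [S f g := X_{f,g} - [X_f, X_g]_s] of the strong condition is a derivation in
   each of [f], [g] and [h] when evaluated at [h], and the symmetric Poisson
   condition says that its cyclic sum vanishes. So both conditions may be tested
   on linear functions, where
   [S iota_u iota_v iota_w = iota_{(u.v).w - u.(v.w) - v.(u.w)}]; the cyclic sum
   of this is minus the Jacobi-Jordan expression, and the strong condition makes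
   all triple products vanish. *)

Require Import Defs.
From HB Require Import structures.
From mathcomp Require Import all_boot all_order all_algebra.
From mathcomp Require Import all_classical all_reals all_analysis.
From mathcomp Require Import ring.

Set Implicit Arguments.
Unset Strict Implicit.
Unset Printing Implicit Defensive.

Import Order.TTheory GRing.Theory Num.Theory.
Import numFieldNormedType.Exports.

Local Open Scope classical_set_scope.
Local Open Scope ring_scope.

(** * Integrals along segments and Hadamard's lemma *)

Section SegmentAverage.
Variables (R : realType) (E : normedModType R).
Implicit Types (f : E -> R) (a x y z v : E).

(** The difference quotient of the restriction to the line at [s] is, as a function of [h], the very
    quotient that defines ['D_v f] at [y + s *: v]. *)
Lemma is_derive_line f y v (s : R) : derivable f (y + s *: v) v ->
  is_derive s 1 (fun s => f (y + s *: v)) ('D_v f (y + s *: v)).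
Proof.
have quotE :
  (fun h : R => h^-1 *: (((fun s => f (y + s *: v)) \o shift s) (h *: 1) -
    f (y + s *: v))) =
  (fun h => h^-1 *: ((f \o shift (y + s *: v)) (h *: v) - f (y + s *: v))).
  apply/funext => h /=; congr (_ *: (f _ - _)).
  by rewrite [h *: _]mulr1 scalerDl addrCA.
move=> df; apply: DeriveDef; first by rewrite /derivable quotE.
by rewrite /derive quotE.
Qed.

Definition segment a x (t : R) : E := a + t *: (x - a).

Lemma segment_continuous a x : continuous (segment a x).
Proof.
move=> t; apply: cvgD; first exact: cvg_cst.
by apply: cvgZr_tmp; exact: cvg_id.
Qed.

(** Joint continuity in [(t, z)] gives the bound near each [(t, 0)]; compactness of the parameter
    interval makes the neighbourhood of 0 uniform in [t]. *)
Lemma segment_perturb f a x : continuous f -> forall eps, 0 < eps ->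
  \forall z \near (0 : E), forall t, t \in `[0, 1]%R ->
    `|f (segment a x t + z) - f (segment a x t)| < eps.
Proof.
move=> cf eps eps0.
have := @segment_compact R 0 1.
move=> /compact_near_coveringP/near_covering_withinP.
move=> /(_ E (nbhs (0 : E)) (fun z t =>
  `|f (segment a x t + z) - f (segment a x t)| < eps)).
apply => t _.
pose g (p : R * E) : R := f (segment a x p.1 + p.2) - f (segment a x p.1).
have cg : continuous g.
  have c1 : continuous (fun p : R * E => segment a x p.1).
    move=> p; apply: continuous_comp; [exact: cvg_fst|exact: segment_continuous].
  move=> p; apply: cvgB.
    apply: (@continuous_comp _ _ _
      (fun p : R * E => segment a x p.1 + p.2) f); last exact: cf.
    by apply: cvgD; [exact: c1|exact: cvg_snd].
  apply: (@continuous_comp _ _ _ (fun p : R * E => segment a x p.1) f).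
    exact: c1.
  exact: cf.
have g0 : g (t, 0) = 0 by rewrite /g /= addr0 subrr.
have /cvgr0Pnorm_lt : g p @[p --> (t, 0 : E)] --> 0 by rewrite -g0; exact: cg.
move=> /(_ _ eps0) H.
near=> p.
by move=> _; near: p; exact: H.
Unshelve. all: by end_near. Qed.

End SegmentAverage.

(** * Integration of continuous functions over the unit interval *)

Section UnitIntegral.
Variable R : realType.
Implicit Types u : R -> R.
Local Notation mu := (@lebesgue_measure R).

Lemma integrable01 u : continuous u -> mu.-integrable `[0, 1] (EFin \o u).
Proof.
move=> cu; apply: continuous_compact_integrable; first exact: segment_compact.
exact: continuous_subspaceT.
Qed.

Definition integral01 u : R := \int[mu]_(t in `[0, 1]) u t.

Lemma integral01D u1 u2 : continuous u1 -> continuous u2 ->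
  integral01 (u1 + u2) = integral01 u1 + integral01 u2.
Proof. by move=> c1 c2; apply: RintegralD => //; exact: integrable01. Qed.

Lemma integral01Z c u : continuous u -> integral01 (c *: u) = c * integral01 u.
Proof. by move=> cu; apply: RintegralZl => //; exact: integrable01. Qed.

Lemma integral01_sum n (c : 'I_n -> R) (u : 'I_n -> R -> R) :
  (forall k, continuous (u k)) ->
  integral01 (\sum_(k < n) c k *: u k) = \sum_(k < n) c k * integral01 (u k).
Proof.
move=> cu.
(* Stated for every index list, so that it applies to the tails met in the induction. *)
have cs r : continuous (\sum_(k <- r) c k *: u k).
  elim/big_ind: _ => [|f g cf cg|k _] x; first exact: cst_continuous.
    by apply: continuousD; [exact: cf|exact: cg].
  by apply: (@continuousZl_tmp _ R^o); exact: cu.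
elim: (index_enum _) cs => [|k r IH] cs.
  by rewrite !big_nil /integral01 Rintegral_cst ?mul0r.
rewrite !big_cons integral01D.
- by rewrite integral01Z// IH.
- by move=> x; apply: (@continuousZl_tmp _ R^o); exact: cu.
- exact: (cs r).
Qed.

Lemma integral01_cst c : integral01 (fun=> c) = c.
Proof.
have mu1 : mu `[0, 1] = 1%E.
  by rewrite lebesgue_measure_itv/= lte_fin ltr01 oppr0 adde0.
by rewrite /integral01 Rintegral_cst//= mu1 mulr1.
Qed.

Lemma normr_integral01_le u (eps : R) : continuous u ->
  (forall t, t \in `[0, 1]%R -> `|u t| <= eps) -> `|integral01 u| <= eps.
Proof.
move=> cu ule.
apply: (le_trans (le_normr_Rintegral _ _)) => //; first exact: integrable01.
rewrite -[leRHS]integral01_cst.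
apply: le_Rintegral => //.
  apply: (@integrable01 (fun t => `|u t|)) => t.
  by apply: (@continuous_comp _ _ _ u Num.norm); [exact: cu|exact: norm_continuous].
by apply: (@integrable01 (fun=> eps)) => t; exact: cst_continuous.
Qed.

Lemma integral01_derive (u du : R -> R) : continuous du ->
  (forall t, is_derive t (1 : R) u (du t)) -> integral01 du = u 1 - u 0.
Proof.
move=> cdu du_u.
have cu : continuous u.
  move=> t; apply: differentiable_continuous; apply/derivable1_diffP.
  by case: (du_u t).
rewrite /integral01 /Rintegral (@continuous_FTC2 _ _ u) ?ltr01//.
- exact: continuous_subspaceT.
- split=> [t _| |]; first by case: (du_u t).
    by apply: cvg_at_right_filter; exact: cu.
  by apply: cvg_at_left_filter; exact: cu.
- by move=> t _; rewrite derive1E; apply: derive_val.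
Qed.

End UnitIntegral.

(** * Smoothness of weighted averages along segments, in coordinates *)

Section SegmentAverageSmooth.
Variables (R : realType) (E : normedModType R) (n : nat).
(** On the dual space [b] will be the dual basis and [x_ k] the evaluation at the [k]-th basis
    vector of [V]; the bound has constant 1 because the norm there is the sup norm of these
    coordinates. *)
Variables (b : 'I_n -> E) (x_ : 'I_n -> {linear E -> R^o}).
Hypothesis basisE : forall v, v = \sum_(k < n) x_ k v *: b k.
Hypothesis coord_le : forall k v, `|x_ k v| <= `|v|.
Implicit Types (f : E -> R) (a x y z v : E).

Lemma derive_expand f x v : differentiable f x ->
  'D_v f x = \sum_(k < n) x_ k v * 'D_(b k) f x.
Proof.
move=> df; rewrite deriveE// [in LHS](basisE v) linear_sum.
by apply: eq_bigr => k _; rewrite linearZ/= deriveE.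
Qed.

(* The weights [t ^+ m] make the family stable under differentiation: see
   [segment_avg_diff]. *)
Definition segment_avg m f a x : R :=
  integral01 (fun t => t ^+ m * f (segment a x t)).

Lemma segment_avg_continuous_integrand m f a x : continuous f ->
  continuous (fun t : R => t ^+ m * f (segment a x t)).
Proof.
move=> cf t; apply: cvgM; first exact: exprn_continuous.
by apply: continuous_comp; [exact: segment_continuous|exact: cf].
Qed.

Lemma segmentD a x h t : segment a (x + h) t = segment a x t + t *: h.
Proof. by rewrite /segment addrAC scalerDr addrA. Qed.

Lemma norm_scale01_le t (h : E) : t \in `[0, 1]%R -> `|t *: h| <= `|h|.
Proof.
rewrite in_itv/= => /andP[t0 t1]; rewrite normrZ ger0_norm//.
by rewrite ler_piMl.
Qed.

Lemma normr_expr01_le m (t r : R) : t \in `[0, 1]%R -> `|t ^+ m * r| <= `|r|.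
Proof.
rewrite in_itv/= => /andP[t0 t1]; rewrite normrM normrX ger0_norm//.
by rewrite ler_piMl// exprn_ile1.
Qed.

Lemma segment_perturb_ball f a x : continuous f -> forall eps, 0 < eps ->
  exists2 r : R, 0 < r & forall z t, `|z| < r -> t \in `[0, 1]%R ->
    `|f (segment a x t + z) - f (segment a x t)| < eps.
Proof.
move=> cf eps eps0.
have /nbhs_normP[r /= r0 rP] := @segment_perturb R E f a x cf eps eps0.
by exists r => // z t zr t01; apply: rP => //=; rewrite /ball_/= sub0r normrN.
Qed.

(** Moving the endpoint by [h] moves the point of parameter [t] by [t *: h], which is no longer than
    [h], so the estimate uniform in [t] applies under the integral. *)
Lemma segment_avg_continuous m f a : continuous f ->
  continuous (segment_avg m f a).
Proof.
move=> cf x; apply/cvgrPdist_le => eps eps0.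
have [r r0 rP] := @segment_perturb_ball f a x cf _ eps0.
apply/nbhs_normP; exists r => //= y; rewrite /ball_/= distrC => yr.
rewrite distrC -(subrKC x y); set h := y - x in yr *.
have ci := @segment_avg_continuous_integrand m f a.
have -> : segment_avg m f a (x + h) - segment_avg m f a x =
    integral01 ((fun t => t ^+ m * f (segment a (x + h) t)) +
      (-1) *: (fun t => t ^+ m * f (segment a x t))).
  rewrite integral01D; [|exact: ci|].
    by rewrite integral01Z ?mulN1r//; exact: ci.
  by move=> t; apply: (@continuousZl_tmp _ R^o); exact: ci.
apply: normr_integral01_le.
  move=> t; apply: continuousD; first exact: ci.
  by apply: (@continuousZl_tmp _ R^o); exact: ci.
move=> t t01; rewrite !fctE /= scaleN1r -mulrBr.
apply: (le_trans (normr_expr01_le _ _ t01)); rewrite segmentD ltW//.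
by apply: rP => //; apply: le_lt_trans yr; exact: norm_scale01_le.
Qed.

(** By the mean value theorem in direction [t *: h], the increment of [f] is a directional
    derivative at an intermediate point; its partial derivatives are close to those at
    [segment a x t], uniformly in [t]. *)
Lemma segment_remainder f a x : Ck 1 f -> forall eps, 0 < eps ->
  exists2 r : R, 0 < r & forall h t, `|h| < r -> t \in `[0, 1]%R ->
    `|f (segment a (x + h) t) - f (segment a x t)
      - t * \sum_(k < n) x_ k h * 'D_(b k) f (segment a x t)|
    <= eps * `|h|.
Proof.
move=> [df cdf] eps eps0.
(* Dividing by [n + 1] rather than [n] covers [n = 0]; the surplus summand is dropped below as
   nonnegative. *)
have [eps' eps'0 epsE] : exists2 eps' : R, 0 < eps' & eps = n.+1%:R * eps'.
  by exists (eps / n.+1%:R); [rewrite divr_gt0|rewrite mulrC divfK ?pnatr_eq0].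
have /choice[r rP] k : exists r : R, 0 < r /\ forall z t, `|z| < r ->
    t \in `[0, 1]%R -> `|'D_(b k) f (segment a x t + z) -
      'D_(b k) f (segment a x t)| < eps'.
  by have [r ? ?] := @segment_perturb_ball _ a x (cdf (b k)) _ eps'0; exists r.
(* The default value 1 supplies a positive radius when there is no index. *)
exists (\big[Num.min/1]_k r k).
  by apply: lt_bigmin => // k _; have [] := rP k.
move=> h t hr t01; set y := segment a x t.
have [s s01 fE] : exists2 s : R, s \in `[0, 1]%R &
    f (y + 1 *: (t *: h)) - f (y + 0 *: (t *: h)) =
    'D_(t *: h) f (y + s *: (t *: h)) * (1 - 0).
  apply: (@MVT_segment _ (fun s => f (y + s *: (t *: h)))) => // [s _|].
    by apply: is_derive_line; exact: diff_derivable.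
  apply: continuous_subspaceT => s.
  apply: continuous_comp; last exact: differentiable_continuous.
  by apply: cvgD; [exact: cvg_cst|apply: cvgZr_tmp; exact: cvg_id].
rewrite scale1r scale0r addr0 subr0 mulr1 in fE.
rewrite segmentD -/y fE (derive_expand _ (df _)) mulr_sumr -sumrB.
have -> : eps * `|h| = \sum_(k < n.+1) eps' * `|h|.
  by rewrite sumr_const card_ord -[RHS]mulr_natl mulrA epsE.
rewrite big_ord_recr /= -[leLHS]addr0 lerD//; last first.
  by rewrite mulr_ge0// ltW.
apply: (le_trans (ler_norm_sum _ _ _)); apply: ler_sum => k _.
have [_ rkP] := rP k.
rewrite linearZ/= [_ *: _]/(_ * _) -!mulrA -!mulrBr normrM.
have th : `|t *: h| <= `|h| by exact: norm_scale01_le.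
move: (t01); rewrite in_itv/= => /andP[t0 t1].
rewrite ger0_norm// -[leRHS]mul1r ler_pM// normrM mulrC ler_pM//.
apply/ltW/rkP => //.
apply: le_lt_trans (lt_le_trans hr _).
  by apply: le_trans th; exact: norm_scale01_le.
by apply: bigmin_le_cond.
Qed.


(** The pointwise remainder estimate is integrated against [t ^+ m]; the factor [t] from the chain
    rule raises the weight to [t ^+ m.+1]. *)
Lemma segment_avg_remainder m f a x : Ck 1 f -> forall eps, 0 < eps ->
  exists2 r : R, 0 < r & forall h, `|h| < r ->
    `|segment_avg m f a (x + h) - segment_avg m f a x
      - \sum_(k < n) x_ k h * segment_avg m.+1 ('D_(b k) f) a x|
    <= eps * `|h|.
Proof.
move=> cf eps eps0; have [r r0 rP] := segment_remainder a x cf eps0.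
exists r => // h hr.
have [df cdf] := cf.
have ci y := @segment_avg_continuous_integrand m f a y (CkW cf).
have cdi k := @segment_avg_continuous_integrand m.+1 _ a x (cdf (b k)).
have cZ (c : R) (u : R -> R) : continuous u -> continuous (c *: u).
  by move=> cu t; apply: (@continuousZl_tmp _ R^o); exact: cu.
have cD (u v : R -> R) : continuous u -> continuous v -> continuous (u + v).
  by move=> cu cv t; apply: continuousD; [exact: cu|exact: cv].
have cS : continuous (\sum_(k < n) x_ k h *:
    (fun t : R => t ^+ m.+1 * 'D_(b k) f (segment a x t))).
  elim/big_ind: _ => [|u v cu cv|k _]; first by move=> t; exact: cst_continuous.
    exact: cD.
  exact: cZ.
rewrite -integral01_sum//; set S := \sum_(k < n) _ in cS *.
have -> : segment_avg m f a (x + h) - segment_avg m f a x - integral01 S =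
    integral01 ((fun t => t ^+ m * f (segment a (x + h) t))
      + (-1) *: (fun t => t ^+ m * f (segment a x t)) + (-1) *: S).
  rewrite !integral01D ?integral01Z ?mulN1r//; do ?exact: cZ.
  by apply: cD => //; exact: cZ.
apply: normr_integral01_le.
  by apply: (cD _ _ _ (cZ _ _ _)) => //; apply: cD => //; exact: cZ.
move=> t t01; apply: le_trans (rP h t hr t01).
apply: le_trans (normr_expr01_le m _ t01).
rewrite /S !fctE /= fct_sumE !scaleN1r !mulrBr mulrA -exprSr mulr_sumr.
rewrite le_eqVlt; apply/orP; left; apply/eqP; congr (`|_ - _|).
by apply: eq_bigr => k _; exact: mulrCA.
Qed.

(** The coordinate bound makes the candidate differential [dg] continuous; by the remainder estimate
    and uniqueness of differentials it is the differential. *)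
Lemma segment_avg_diff m f a x : Ck 1 f ->
  differentiable (segment_avg m f a) x /\
  forall v, 'D_v (segment_avg m f a) x =
    \sum_(k < n) x_ k v * segment_avg m.+1 ('D_(b k) f) a x.
Proof.
move=> cf.
pose dg v : R^o := \sum_(k < n) x_ k v * segment_avg m.+1 ('D_(b k) f) a x.
have dg_lin : linear dg.
  move=> c u v; rewrite /dg scaler_sumr -big_split; apply: eq_bigr => k _ /=.
  by rewrite linearP mulrDl -scalerAl.
pose dgL : {linear E -> R^o} :=
  HB.pack dg (GRing.isLinear.Build _ _ _ _ dg dg_lin).
have dgc : continuous dgL.
  apply/linear_bounded_continuous/linear_boundedP; near=> M => v.
  rewrite /= /dg; apply: (le_trans (ler_norm_sum _ _ _)).
  apply: (@le_trans _ _
    ((\sum_(k < n) `|segment_avg m.+1 ('D_(b k) f) a x|) * `|v|)).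
    rewrite mulr_suml; apply: ler_sum => k _; rewrite normrM mulrC.
    by rewrite ler_wpM2l.
  by rewrite ler_wpM2r//; near: M; apply: nbhs_pinfty_ge; exact: num_real.
have dgo : segment_avg m f a \o shift x =
    cst (segment_avg m f a x) + dgL +o_ (0 : E) id.
  apply/eqaddoP => eps eps0; have [r r0 rP] := segment_avg_remainder m a x cf eps0.
  apply/nbhs_normP; exists r => //= h; rewrite /ball_/= sub0r normrN => /rP.
  by rewrite !fctE /= [h + x]addrC opprD addrA.
have dE := diff_unique dgc dgo.
have dd : differentiable (segment_avg m f a) x.
  by apply/diff_locallyP; rewrite dE; split.
by split=> // v; rewrite deriveE// dE.
Unshelve. all: by end_near. Qed.

(** Each derivative is a combination of averages of partial derivatives with the next weight, so the
    induction runs over all [m] and [f]. One order is lost because differentiation under the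
    integral asks for a C^1 integrand. *)
Lemma segment_avg_Ck k m f a : Ck k.+1 f -> Ck k (segment_avg m f a).
Proof.
elim: k m f => [|k IH] m f cf.
  by apply: segment_avg_continuous; exact: CkW cf.
have cf1 : Ck 1 f by elim: k.+1 cf => [//|j IHj] /CkW/IHj.
split=> [x|v]; first by have [] := segment_avg_diff m a x cf1.
have -> : 'D_v (segment_avg m f a) =
    \sum_(j < n) x_ j v *: segment_avg m.+1 ('D_(b j) f) a.
  apply/funext => x; rewrite fct_sumE.
  by have [_ ->] := segment_avg_diff m a x cf1.
elim/big_ind: _ => [|g h|j _]; [exact: Ck_cst|exact: CkD|apply: CkZ].
by apply: IH; case: cf => _; apply.
Qed.

Lemma segment_avg_smooth m f a : smooth f -> smooth (segment_avg m f a).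
Proof. by move=> sf k; apply: segment_avg_Ck. Qed.

Lemma segment_avg0_diag f a : segment_avg 0 f a a = f a.
Proof.
rewrite /segment_avg /segment subrr.
under [fun t => _]funext => t do rewrite scaler0 addr0 expr0 mul1r.
exact: integral01_cst.
Qed.

(** The fundamental theorem of calculus is applied to [f] along the segment from [a] to [x], with
    the derivative ['D_(x - a) f] expanded in coordinates. *)
Lemma hadamard f a x : Ck 1 f ->
  f x = f a + \sum_(k < n) x_ k (x - a) * segment_avg 0 ('D_(b k) f) a x.
Proof.
move=> [df cdf].
have cdi k := @segment_avg_continuous_integrand 0 _ a x (cdf (b k)).
rewrite -integral01_sum//; set S := \sum_(k < n) _.
suff -> : integral01 S = f (segment a x 1) - f (segment a x 0).
  by rewrite /segment scale1r scale0r addr0 subrKC addrC subrK.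
apply: (@integral01_derive _ (fun t => f (segment a x t))).
  rewrite /S; elim/big_ind: _ => [|u v cu cv|k _] t; first exact: cst_continuous.
    by apply: continuousD; [exact: cu|exact: cv].
  by apply: (@continuousZl_tmp _ R^o); exact: cdi.
move=> t.
have -> : S t = 'D_(x - a) f (segment a x t).
  rewrite /S fct_sumE derive_expand//; apply: eq_bigr => k _.
  by rewrite !fctE expr0 mul1r.
by apply: is_derive_line; exact: diff_derivable.
Qed.

End SegmentAverageSmooth.

(** * Derivations and the defect of the strong condition *)

Section SmoothAlgebra.
Variables (R : realType) (E : normedModType R).
Local Notation Cinf := (smoothfun E).
Implicit Types (f g h p q : Cinf) (X Y Z : vfield E) (D : Cinf -> Cinf).

Lemma smoothfunE f g : f =1 g -> f = g.
Proof. by move=> fg; apply/val_inj/funext. Qed.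

Lemma smoothfun_addE f g x : (f + g) x = f x + g x.
Proof. by []. Qed.

Lemma smoothfun_subE f g x : (f - g) x = f x - g x.
Proof. by []. Qed.

Lemma smoothfun_mulE f g x : (f * g) x = f x * g x.
Proof. by []. Qed.

Lemma smoothfun_cstE (c : R) x : (c *: (1 : Cinf)) x = c.
Proof. exact: mulr1. Qed.

Lemma smoothfun_sumE I (r : seq I) (F : I -> Cinf) x :
  (\sum_(i <- r) F i) x = \sum_(i <- r) F i x.
Proof. by elim/big_rec2: _ => [//|i y s _ <-]. Qed.

Lemma smoothfun_scaleE (c : R) f : c *: f = (c *: (1 : Cinf)) * f.
Proof.
apply: smoothfunE => x.
exact: (congr1 (fun a => a * f x) (esym (mulr1 c))).
Qed.

Lemma derivation1 D : derivation D -> D 1 = 0.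
Proof.
move=> [_ DM]; have := DM 1 1; rewrite !mulr1 mul1r => /eqP.
by rewrite -subr_eq subrr => /eqP.
Qed.

Lemma derivationD D : derivation D -> {morph D : f g / f + g}.
Proof. by move=> [Dl _] f g; have := Dl 1 f g; rewrite !scale1r. Qed.

Lemma derivation0 D : derivation D -> D 0 = 0.
Proof. by move=> [_ DM]; have := DM 0 0; rewrite !mulr0 mul0r addr0. Qed.

Lemma derivationZ D (c : R) f : derivation D -> D (c *: f) = c *: D f.
Proof.
by move=> dD; case: (dD) => Dl _; have := Dl c f 0; rewrite (derivation0 dD) !addr0.
Qed.

Lemma derivationB D : derivation D -> {morph D : f g / f - g}.
Proof.
by move=> dD f g; rewrite (derivationD dD) -scaleN1r (derivationZ _ _ dD) scaleN1r.
Qed.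

Lemma derivation_cst D (c : R) : derivation D -> D (c *: (1 : Cinf)) = 0.
Proof. by move=> dD; rewrite derivationZ// derivation1// scaler0. Qed.

Lemma derivation_sum D I (r : seq I) (F : I -> Cinf) : derivation D ->
  D (\sum_(i <- r) F i) = \sum_(i <- r) D (F i).
Proof.
move=> dD; elim: r => [|i r IH]; first by rewrite !big_nil derivation0.
by rewrite !big_cons derivationD// IH.
Qed.

(** Scaling is multiplication by a constant function, so the Leibniz rule reduces homogeneity to the
    vanishing on constants. *)
Lemma derivationI D : {morph D : f g / f + g} ->
  (forall f g, D (f * g) = D f * g + f * D g) ->
  (forall c : R, D (c *: (1 : Cinf)) = 0) -> derivation D.
Proof.
move=> DD DM Dc; split=> // c f g.
by rewrite DD (smoothfun_scaleE c f) (smoothfun_scaleE c (D f)) DM Dc mul0r add0r.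
Qed.

Lemma derivation_add D1 D2 : derivation D1 -> derivation D2 ->
  derivation (fun f => D1 f + D2 f).
Proof.
move=> d1 d2; apply: derivationI => [f g|f g|c].
- by rewrite (derivationD d1) (derivationD d2) addrACA.
- by case: d1 d2 => _ -> [_ ->]; ring.
- by rewrite (derivation_cst _ d1) (derivation_cst _ d2) addr0.
Qed.

Lemma vfield_derivation X : derivation X.
Proof. by apply/asboolP; exact: vfieldP. Qed.

Lemma vfield_sumE I (r : seq I) (F : I -> vfield E) f :
  (\sum_(i <- r) F i) f = \sum_(i <- r) F i f.
Proof. by elim/big_rec2: _ => [//|i y s _ <-]. Qed.

Lemma vfieldE X Y : X =1 Y -> X = Y.
Proof. by move=> XY; apply/val_inj/funext. Qed.

Lemma vfield_zeroE f : (0 : vfield E) f = 0.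
Proof. by []. Qed.

Lemma vfield_addE X Y f : (X + Y) f = X f + Y f.
Proof. by []. Qed.

Lemma vfield_scaleE (a : Cinf) X f : (a *: X) f = a * X f.
Proof. by []. Qed.

Lemma commutator_derivation X Y : derivation (fun f => X (Y f) - Y (X f)).
Proof.
have dX := vfield_derivation X; have dY := vfield_derivation Y.
have [[_ XM] [_ YM]] := (dX, dY).
apply: derivationI => [f g|f g|c].
- by rewrite (derivationD dX) (derivationD dY) (derivationD dX) (derivationD dY); ring.
- rewrite XM YM (derivationD dX) (derivationD dY) !XM !YM; ring.
- rewrite (derivation_cst _ dX) (derivation_cst _ dY).
  by rewrite (derivation0 dX) (derivation0 dY) subrr.
Qed.

End SmoothAlgebra.

(** * The defect of the strong condition as a derivation in each argument *)

Section Defect.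
Variables (R : realType) (E : normedModType R).
Local Notation Cinf := (smoothfun E).
Variables (nabla : vfield E -> vfield E -> vfield E).
Hypothesis nablaP : torsion_free_connection nabla.
Variable B : sym_poisson_bracket E.
Implicit Types (f g h p q : Cinf) (X Y Z : vfield E) (D : Cinf -> Cinf).

Lemma spbracket_derivation f : derivation (B f).
Proof. exact: (vfield_derivation (grad B f)). Qed.

Definition strong_defect f g : vfield E :=
  grad B (B f g) - sym_bracket nabla (grad B f) (grad B g).

Lemma strong_defectE f g h : strong_defect f g h =
  B (B f g) h - (nabla (grad B f) (grad B g) h + nabla (grad B g) (grad B f) h).
Proof. by []. Qed.

Lemma strong_defectC f g : strong_defect f g = strong_defect g f.
Proof.
rewrite /strong_defect spbracketC /sym_bracket; congr (_ - _).
exact: addrC.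
Qed.

Lemma gradE f g : grad B f g = B f g.
Proof. by []. Qed.

Lemma gradD f g : grad B (f + g) = grad B f + grad B g.
Proof.
apply: vfieldE => h; rewrite vfield_addE !gradE.
by rewrite -!(spbracketC _ h) (derivationD (spbracket_derivation h)).
Qed.

Lemma gradM f g : grad B (f * g) = f *: grad B g + g *: grad B f.
Proof.
apply: vfieldE => h; rewrite vfield_addE !vfield_scaleE !gradE.
by rewrite -!(spbracketC _ h) spbracketM; ring.
Qed.

Lemma grad_cst (c : R) : grad B (c *: (1 : Cinf)) = 0.
Proof.
apply: vfieldE => h; rewrite vfield_zeroE gradE spbracketC.
exact: (derivation_cst _ (spbracket_derivation h)).
Qed.

Let nablaDl X Y Z : nabla (X + Y) Z = nabla X Z + nabla Y Z.
Proof. by have := connection_linearl nablaP Z 1 X Y; rewrite !scale1r. Qed.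

Let nabla0l Z : nabla 0 Z = 0.
Proof.
by have := nablaDl 0 0 Z; rewrite addr0 => /eqP; rewrite -subr_eq subrr => /eqP.
Qed.

Let nablaZl f X Z : nabla (f *: X) Z = f *: nabla X Z.
Proof. by have := connection_linearl nablaP Z f X 0; rewrite nabla0l !addr0. Qed.

Let nablaDr X Y Z : nabla X (Y + Z) = nabla X Y + nabla X Z.
Proof. exact: connection_additive. Qed.

Let nabla0r X : nabla X 0 = 0.
Proof.
by have := nablaDr X 0 0; rewrite addr0 => /eqP; rewrite -subr_eq subrr => /eqP.
Qed.

Let nablaZr f X Z : nabla X (f *: Z) = X f *: Z + f *: nabla X Z.
Proof. exact: connection_leibniz. Qed.

(** On a product [p * q] the iterated bracket produces the cross terms
    [B p h * B q g + B q h * B p g]. The Leibniz rule of [nabla] in its second argument produces the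
    same terms, and they cancel. *)
Lemma strong_defect_derivationl g h : derivation (fun f => strong_defect f g h).
Proof.
have Bl p q : B (p + q) g = B p g + B q g.
  by rewrite -!(spbracketC _ g) (derivationD (spbracket_derivation g)).
have Blh p q : B (p + q) h = B p h + B q h.
  by rewrite -!(spbracketC _ h) (derivationD (spbracket_derivation h)).
apply: derivationI => [p q|p q|c]; rewrite !strong_defectE.
- by rewrite Bl Blh gradD nablaDl nablaDr !vfield_addE; ring.
- rewrite gradM nablaDl nablaDr !nablaZl !nablaZr.
  rewrite !vfield_addE !vfield_scaleE !gradE.
  rewrite -!(spbracketC _ h) -!(spbracketC _ g).
  rewrite !spbracketM (derivationD (spbracket_derivation h)) !spbracketM; ring.
- rewrite grad_cst nabla0l nabla0r !vfield_zeroE.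
  rewrite -!(spbracketC _ h) -!(spbracketC _ g).
  rewrite (derivation_cst _ (spbracket_derivation g)).
  by rewrite (derivation0 (spbracket_derivation h)) addr0 subr0.
Qed.

Lemma strong_defect_derivationm f h : derivation (fun g => strong_defect f g h).
Proof.
have := strong_defect_derivationl f h.
by congr derivation; apply/funext => g; rewrite strong_defectC.
Qed.

End Defect.

(** * Derivations and the Euclidean connection on the dual space *)

Section DualDerivations.
Variables (R : realType) (V : vectType R).
Local Notation E := (dualspace V).
Local Notation Cinf := (smoothfun E).
Local Notation n := (\dim {:V}).
Local Notation e := (vbasis {:V}).
Local Notation d k := (@dual_basis R V k).
Implicit Types (f g h p q : Cinf) (X Y Z : vfield E) (D : Cinf -> Cinf).

Lemma dual_basisE k u : d k u = coord e k u.
Proof. by rewrite /dual_basis lfunE. Qed.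

Lemma dual_expand (v : E) : v = \sum_(k < n) iota_fun e`_k v *: d k.
Proof.
apply/lfunP => u; rewrite {1}(coord_vbasis (memvf u)) linear_sum sum_lfunE.
by apply: eq_bigr => k _; rewrite linearZ/= scale_lfunE dual_basisE; exact: mulrC.
Qed.

Lemma dual_coord_le (k : 'I_n) (v : E) : `|iota_fun e`_k v| <= `|v|.
Proof.
have -> : `|v| = mx_norm (dual_coord v) by [].
rewrite mx_normrE; have -> : iota_fun e`_k v = dual_coord v 0 k by rewrite mxE.
exact: (le_bigmax _ (fun ij => `|dual_coord v ij.1 ij.2|) (0, k)).
Qed.

Lemma smoothP f : smooth f.
Proof. by apply/asboolP; exact: smoothfunP. Qed.

(** Both sides are compared at a point [a]. Hadamard's expansion about [a] has smooth coefficients,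
    so it is an identity in the algebra to which [D] applies. *)
Lemma derivation_expand D f : derivation D ->
  D f = \sum_(k < n) D (lin_iota e`_k) * partial (d k) f.
Proof.
move=> dD; apply: smoothfunE => a.
have Gs k : segment_avg 0 (partial (d k) f) a \in smooth_pred.
  apply/asboolP; apply: (segment_avg_smooth dual_expand dual_coord_le).
  exact: smoothP.
pose G k : Cinf := SmoothFun (Gs k).
have fE : f = f a *: (1 : Cinf) +
    \sum_(k < n) (lin_iota e`_k - iota_fun e`_k a *: (1 : Cinf)) * G k.
  apply: smoothfunE => x.
  have f1 : Ck 1 f by exact: smoothP.
  rewrite (hadamard dual_expand a x f1) smoothfun_addE smoothfun_cstE.
  congr (_ + _); rewrite smoothfun_sumE; apply: eq_bigr => k _.
  by rewrite smoothfun_mulE smoothfun_subE smoothfun_cstE linearB.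
rewrite {1}fE (derivationD dD) (derivation_cst _ dD) add0r (derivation_sum _ _ dD).
rewrite !smoothfun_sumE; apply: eq_bigr => k _.
(* At [a] the terms with [D (G k)] carry a factor that vanishes there, and [G k a] is the [k]-th
   partial derivative of [f] at [a]. *)
case: (dD) => _ ->; rewrite (derivationB dD) (derivation_cst _ dD) subr0.
rewrite smoothfun_addE !smoothfun_mulE smoothfun_subE smoothfun_cstE.
by rewrite subrr mul0r addr0 /= segment_avg0_diag.
Qed.

Lemma lin_iota_linear : linear (@lin_iota R V).
Proof. by move=> c u v; apply: smoothfunE => x; rewrite /= /iota_fun linearP. Qed.

HB.instance Definition _ :=
  GRing.isLinear.Build R V Cinf _ (@lin_iota R V) lin_iota_linear.

Lemma lin_iota_inj : injective (@lin_iota R V).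
Proof.
move=> u v uv; rewrite (coord_vbasis (memvf u)) (coord_vbasis (memvf v)).
apply: eq_bigr => k _; congr (_ *: _).
have := congr1 (fun f : Cinf => f (d k)) uv.
by rewrite /= /iota_fun !dual_basisE.
Qed.

Lemma smooth_lin_iota u : @smooth_lin R V (lin_iota u).
Proof. by move=> c x y; rewrite /= linearP. Qed.

Lemma smooth_linE f : @smooth_lin R V f ->
  f = lin_iota (\sum_(k < n) f (d k) *: e`_k).
Proof.
move=> fl; apply: smoothfunE => v; rewrite [in LHS](dual_expand v).
pose fL : {scalar E} := HB.pack (f : E -> R)
  (GRing.isLinear.Build _ _ _ _ (f : E -> R) fl).
rewrite [LHS](linear_sum fL) [RHS](linear_sum v); apply: eq_bigr => k _.
by rewrite [LHS](linearZ_LR fL) [RHS](linearZ_LR v); exact: mulrC.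
Qed.

(** Expanding the three arguments in turn leaves only values of [T] on linear coordinates. *)
Lemma triderivation_eq0 (T : Cinf -> Cinf -> Cinf -> Cinf) :
  (forall g h, derivation (fun f => T f g h)) ->
  (forall f h, derivation (fun g => T f g h)) ->
  (forall f g, derivation (T f g)) ->
  (forall u v w, T (lin_iota u) (lin_iota v) (lin_iota w) = 0) ->
  forall f g h, T f g h = 0.
Proof.
move=> d1 d2 d3 T0 f g h.
rewrite (derivation_expand f (d1 g h)) big1// => i _.
rewrite (derivation_expand g (d2 _ h)) big1 ?mul0r// => j _.
rewrite (derivation_expand h (d3 _ _)) big1 ?mul0r// => k _.
by rewrite T0 mul0r.
Qed.


Lemma lin_iota_expand u : lin_iota u = \sum_(k < n) coord e k u *: lin_iota e`_k.
Proof.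
rewrite {1}(coord_vbasis (memvf u)) linear_sum.
by apply: eq_bigr => k _; rewrite linearZ.
Qed.

Lemma partial_lin_iota k u :
  partial (d k) (lin_iota u) = coord e k u *: (1 : Cinf).
Proof.
apply: smoothfunE => x; rewrite smoothfun_cstE.
by rewrite -[RHS]dual_basisE; exact: (congr1 (@^~ x) (partial_iota (d k) u)).
Qed.

Lemma euclidean_connectionE X Y h : euclidean_connection X Y h =
  \sum_(k < n) X (Y (lin_iota e`_k)) * partial (d k) h.
Proof. by rewrite /euclidean_connection vfield_sumE. Qed.

(** The definition gives this on the coordinates; [lin_iota u] is a combination of them with
    constant coefficients, which pass through [X] and [Y]. *)
Lemma euclidean_connection_iota X Y u :
  euclidean_connection X Y (lin_iota u) = X (Y (lin_iota u)).
Proof.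
rewrite euclidean_connectionE [in RHS]lin_iota_expand.
rewrite (derivation_sum _ _ (vfield_derivation Y)).
rewrite (derivation_sum _ _ (vfield_derivation X)).
apply: eq_bigr => k _; rewrite partial_lin_iota.
rewrite (derivationZ _ _ (vfield_derivation Y)).
rewrite (derivationZ _ _ (vfield_derivation X)) [RHS]smoothfun_scaleE.
exact: mulrC.
Qed.

(** The Leibniz and torsion identities rest on recovering a vector field from its components by
    [derivation_expand], applied to [Y] for the former and to the commutator of [X] and [Y] for the
    latter. *)
Lemma euclidean_connection_torsion_free :
  torsion_free_connection (@euclidean_connection R V).
Proof.
split=> [Y f X X'|X Y Z|X Y f|X Y f].
- apply: vfieldE => h.
  rewrite vfield_addE vfield_scaleE !euclidean_connectionE mulr_sumr -big_split.
  by apply: eq_bigr => k _; rewrite vfield_addE vfield_scaleE /=; ring.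
- apply: vfieldE => h; rewrite vfield_addE !euclidean_connectionE -big_split.
  apply: eq_bigr => k _; rewrite vfield_addE (derivationD (vfield_derivation X)).
  exact: mulrDl.
- apply: vfieldE => h; rewrite vfield_addE !vfield_scaleE !euclidean_connectionE.
  rewrite [Y h](derivation_expand _ (vfield_derivation Y)) !mulr_sumr -big_split.
  apply: eq_bigr => k _; rewrite vfield_scaleE.
  by have [_ ->] := vfield_derivation X; rewrite /=; ring.
- rewrite !euclidean_connectionE -sumrB.
  rewrite [RHS](derivation_expand _ (commutator_derivation X Y)).
  by apply: eq_bigr => k _; rewrite mulrBl.
Qed.

End DualDerivations.

(** * Linear brackets and Jacobi-Jordan products *)

Section Characterisation.
Variables (R : realType) (E : normedModType R).
Variables (nabla : vfield E -> vfield E -> vfield E).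
Hypothesis nablaP : torsion_free_connection nabla.
Variable B : sym_poisson_bracket E.
Local Notation S := (strong_defect nabla B).

Lemma strong_sym_poisson_structureE :
  strong_sym_poisson_structure B nabla <-> forall f g h, S f g h = 0.
Proof.
split=> [[_ sB] f g h|S0]; first by rewrite /strong_defect sB subrr vfield_zeroE.
by split=> // f g; apply/eqP; rewrite -subr_eq0; apply/eqP/vfieldE => h; exact: S0.
Qed.

Lemma sym_poisson_structureE :
  sym_poisson_structure B nabla <->
  forall f g h, S f g h + S g h f + S h f g = 0.
Proof.
have key f g h : S f g h + S g h f + S h f g =
    B f (B g h) + B g (B h f) + B h (B f g)
    - (sym_bracket nabla (grad B f) (grad B g) h
      + sym_bracket nabla (grad B g) (grad B h) f
      + sym_bracket nabla (grad B h) (grad B f) g).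
  rewrite !strong_defectE /sym_bracket !vfield_addE.
  rewrite (spbracketC B (B f g)) (spbracketC B (B g h)).
  by rewrite (spbracketC B (B h f)); ring.
split=> [[_ H] f g h|H]; first by rewrite key H subrr.
by split=> // f g h; apply/eqP; rewrite -subr_eq0 -key H.
Qed.

End Characterisation.

(** * Brackets on the dual space represented by products on [V] *)

Section LinearBrackets.
Variables (R : realType) (V : vectType R).
Local Notation E := (dualspace V).
Local Notation Cinf := (smoothfun E).
Local Notation n := (\dim {:V}).
Local Notation e := (vbasis {:V}).
Local Notation d k := (@dual_basis R V k).
Local Notation nabla := (@euclidean_connection R V).
Implicit Types (B : sym_poisson_bracket E) (m : V -> V -> V).

Definition represents B m :=
  forall u v, B (lin_iota u) (lin_iota v) = lin_iota (m u v).

(** Evaluation on the dual basis reads off the vector that represents a linear function. The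
    definition is total, but its value is meaningful only for linear brackets. *)
Definition dual_product B u v : V :=
  \sum_(k < n) B (lin_iota u) (lin_iota v) (d k) *: e`_k.

Lemma linear_bracketP B : linear_bracket B -> represents B (dual_product B).
Proof. by move=> lB u v; apply/smooth_linE/lB; exact: smooth_lin_iota. Qed.

Lemma represents_linear B m : represents B m -> linear_bracket B.
Proof.
move=> Bm f g /smooth_linE-> /smooth_linE->; rewrite Bm.
exact: smooth_lin_iota.
Qed.

(** A bracket is a derivation in each argument, hence determined by its values on pairs of linear
    coordinates. *)
Lemma represents_inj B B' m : represents B m -> represents B' m -> B = B'.
Proof.
move=> Bm B'm; have BB f g : B f g = B' f g.
  rewrite (derivation_expand _ (spbracket_derivation B f)).
  rewrite (derivation_expand _ (spbracket_derivation B' f)).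
  apply: eq_bigr => j _; congr (_ * _); rewrite !(spbracketC _ f).
  rewrite (derivation_expand _ (spbracket_derivation B _)).
  rewrite (derivation_expand _ (spbracket_derivation B' _)).
  by apply: eq_bigr => i _; rewrite Bm B'm.
(* Equality of the records reduces to equality of the underlying maps by proof irrelevance. *)
case: B B' BB {Bm B'm} => b p1 p2 p3 p4 [b' q1 q2 q3 q4] /= BB.
have {}BB : b = b' by apply/funext => f; apply/funext => g; exact: BB.
subst b'; congr SymPoissonBracket; exact: Prop_irrelevance.
Qed.

Lemma represents_product_inj B m m' :
  represents B m -> represents B m' -> m = m'.
Proof.
move=> Bm Bm'; apply/funext => u; apply/funext => v; apply: lin_iota_inj.
by rewrite -Bm -Bm'.
Qed.

Lemma represents_commutative B m : represents B m -> commutative m.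
Proof. by move=> Bm u v; apply: lin_iota_inj; rewrite -!Bm spbracketC. Qed.

Lemma represents_linearl B m v : represents B m -> linear (m^~ v).
Proof.
move=> Bm c u w; apply: lin_iota_inj; rewrite linearP/= -!Bm linearP.
exact: spbracket_linearl.
Qed.

Lemma represents_linearr B m u : represents B m -> linear (m u).
Proof.
move=> Bm c v w; apply: lin_iota_inj; rewrite linearP/= -!Bm linearP.
exact: spbracket_linearr.
Qed.

Lemma lin_iotaD (u v : V) : lin_iota (u + v) = lin_iota u + lin_iota v.
Proof. exact: linearD. Qed.

Lemma lin_iotaB (u v : V) : lin_iota (u - v) = lin_iota u - lin_iota v.
Proof. exact: linearB. Qed.

Lemma represents_strong_defect B m u v w : represents B m ->
  strong_defect nabla B (lin_iota u) (lin_iota v) (lin_iota w) =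
  lin_iota (m (m u v) w - (m u (m v w) + m v (m u w))).
Proof.
move=> Bm; rewrite strong_defectE !euclidean_connection_iota !gradE !Bm.
by rewrite lin_iotaB lin_iotaD.
Qed.

Lemma represents_strong B m : represents B m ->
  strong_sym_poisson_structure B nabla <->
  forall u v w, m (m u v) w = m u (m v w) + m v (m u w).
Proof.
move=> Bm; have tf := euclidean_connection_torsion_free V.
rewrite (strong_sym_poisson_structureE tf); split=> [S0 u v w|mE].
  apply/eqP; rewrite -subr_eq0; apply/eqP/lin_iota_inj.
  by rewrite -(represents_strong_defect _ _ _ Bm) S0 linear0.
apply: triderivation_eq0 => [g h|f h|f g|u v w].
- exact: strong_defect_derivationl.
- exact: strong_defect_derivationm.
- exact: vfield_derivation.
- by rewrite (represents_strong_defect _ _ _ Bm) mE subrr linear0.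
Qed.

Lemma represents_sym B m : represents B m ->
  sym_poisson_structure B nabla <->
  forall u v w, m u (m v w) + m v (m w u) + m w (m u v) = 0.
Proof.
move=> Bm; have tf := euclidean_connection_torsion_free V.
have mC := represents_commutative Bm.
have key u v w : let S := strong_defect nabla B in
    S (lin_iota u) (lin_iota v) (lin_iota w) +
    S (lin_iota v) (lin_iota w) (lin_iota u) +
    S (lin_iota w) (lin_iota u) (lin_iota v) =
    - lin_iota (m u (m v w) + m v (m w u) + m w (m u v)).
  move=> S; rewrite /S !(represents_strong_defect _ _ _ Bm).
  (* Up to commutativity, each of the three triple products occurs once with a plus sign and twice
     with a minus sign. *)
  rewrite (mC (m u v)) (mC (m v w)) (mC (m w u)) (mC u w) (mC v u) (mC w v).
  by rewrite !(lin_iotaB, lin_iotaD); ring.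
rewrite (sym_poisson_structureE tf); split=> [S0 u v w|mJ].
  by apply: lin_iota_inj; apply/eqP; rewrite linear0 -oppr_eq0 -key S0.
apply: triderivation_eq0 => [g h|f h|f g|u v w].
(* In the cyclic sum each variable occupies each of the three slots of the defect exactly once. *)
- apply: derivation_add; first apply: derivation_add.
  + exact: strong_defect_derivationl.
  + exact: vfield_derivation.
  + exact: strong_defect_derivationm.
- apply: derivation_add; first apply: derivation_add.
  + exact: strong_defect_derivationm.
  + exact: strong_defect_derivationl.
  + exact: vfield_derivation.
- apply: derivation_add; first apply: derivation_add.
  + exact: vfield_derivation.
  + exact: strong_defect_derivationm.
  + exact: strong_defect_derivationl.
- by rewrite key mJ linear0 oppr0.
Qed.

(** Both sides force all triple products to vanish. The strong identity at [(u, v, w)] and at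
    [(w, u, v)] gives [m u (m v w) *+ 2 = 0]; associativity and commutativity make the three
    Jacobi-Jordan terms equal, so three times each is 0. *)
Lemma jacobi_jordan_associativeP m : commutative m ->
  (forall u v w, m (m u v) w = m u (m v w) + m v (m u w)) <->
  (forall u v w, m u (m v w) + m v (m w u) + m w (m u v) = 0) /\ associative m.
Proof.
have eq0 (k : nat) (x : V) : (0 < k)%N -> x *+ k = 0 -> x = 0.
  move=> k0 /eqP; rewrite -scaler_nat scaler_eq0 pnatr_eq0.
  by case: eqP k0 => [->//|_ _ /eqP].
move=> mC; split=> [mE|[mJ mA] u v w].
  have m0 u v w : m u (m v w) = 0.
    apply: (eq0 2) => //; rewrite mulr2n.
    have := mE w u v; have := mE u v w.
    rewrite (mC (m u v)) (mC (m w u)) (mC u w) (mC w v) => -> /eqP.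
    by rewrite addrAC -subr_eq0 opprD addrCA subrr addr0 oppr_eq0 => /eqP.
  by split=> [u v w|u v w]; rewrite ?(mC (m u v)) !m0 ?addr0.
have m0 u' v' w' : m u' (m v' w') = 0.
  apply: (eq0 3) => //; rewrite -[RHS](mJ u' v' w').
  have -> : m v' (m w' u') = m u' (m v' w') by rewrite mA mC.
  have -> : m w' (m u' v') = m u' (m v' w') by rewrite mC mA.
  by rewrite mulrS mulr2n addrA.
by rewrite (mC (m u v)) !m0 addr0.
Qed.

(** The witness [b] is the bracket of the symmetric bivector field whose coefficients are the linear
    functions of the basis products; its symmetry comes from commutativity of [m]. *)
Lemma represents_exists m : (forall v, linear (m^~ v)) ->
  (forall u, linear (m u)) -> commutative m -> exists B, represents B m.
Proof.
move=> ml mr mC.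
pose b (f g : Cinf) : Cinf := \sum_(i < n) \sum_(j < n)
  partial (d i) f * partial (d j) g * lin_iota (m e`_i e`_j).
have dpartial i : derivation (partial (d i)) by exact: vfield_derivation.
have bC f g : b f g = b g f.
  rewrite /b exchange_big; apply: eq_bigr => i _; apply: eq_bigr => j _ /=.
  by rewrite (mC e`_j) (mulrC (partial _ f)).
have br f : derivation (b f).
  apply: derivationI => [g h|g h|c].
  - rewrite /b -big_split; apply: eq_bigr => i _; rewrite -big_split.
    by apply: eq_bigr => j _; rewrite (derivationD (dpartial j)) mulrDr mulrDl.
  - rewrite /b mulr_suml mulr_sumr -big_split; apply: eq_bigr => i _.
    rewrite mulr_suml mulr_sumr -big_split; apply: eq_bigr => j _.
    by have [_ ->] := dpartial j; rewrite /=; ring.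
  - rewrite /b big1// => i _; rewrite big1// => j _.
    by rewrite (derivation_cst _ (dpartial j)) mulr0 mul0r.
have bl g : linear (b^~ g).
  by move=> c f h; rewrite /= !(bC _ g); have [-> _] := br g.
exists (SymPoissonBracket bl (fun f => (br f).1) bC (fun f => (br f).2)) => u v.
have expand (g : {linear V -> V}) w : g w = \sum_(k < n) coord e k w *: g e`_k.
  rewrite {1}(coord_vbasis (memvf w)) linear_sum.
  by apply: eq_bigr => k _; rewrite linearZ.
pose mlL w : {linear V -> V} :=
  HB.pack (m^~ w) (GRing.isLinear.Build _ _ _ _ (m^~ w) (ml w)).
pose mrL w : {linear V -> V} :=
  HB.pack (m w) (GRing.isLinear.Build _ _ _ _ (m w) (mr w)).
have -> : m u v = \sum_(i < n) \sum_(j < n)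
    coord e i u *: (coord e j v *: m e`_i e`_j).
  rewrite -[LHS]/(mlL v u) expand; apply: eq_bigr => i _.
  by rewrite -scaler_sumr; congr (_ *: _); exact: (expand (mrL e`_i)).
rewrite /= /b linear_sum; apply: eq_bigr => i _.
rewrite linear_sum; apply: eq_bigr => j _; rewrite !partial_lin_iota !linearZ/=.
rewrite -mulrA [RHS]smoothfun_scaleE; congr (_ * _).
exact/esym/smoothfun_scaleE.
Qed.

End LinearBrackets.

(** * The two bijections *)

Theorem theorem8p6 (R : realType) (V : vectType R) :
  exists Phi : sym_poisson_bracket (dualspace V) -> (V -> V -> V),
  let nabla := @euclidean_connection R V in
  let linear_sym_poisson :=
    [set B | linear_bracket B /\ sym_poisson_structure B nabla] in
  let linear_strong_sym_poisson :=
    [set B | linear_bracket B /\ strong_sym_poisson_structure B nabla] in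
  [/\ forall B, linear_bracket B ->
        forall u v, lin_iota (Phi B u v) = B (lin_iota u) (lin_iota v),
      set_bij linear_sym_poisson [set m | jacobi_jordan m] Phi,
      linear_strong_sym_poisson `<=` linear_sym_poisson &
      set_bij linear_strong_sym_poisson
        [set m | jacobi_jordan m /\ associative m] Phi].
Proof.
exists (@dual_product R V) => nabla sym strong.
have jjP B (m : V -> V -> V) : represents B m ->
    (forall u v w, m u (m v w) + m v (m w u) + m w (m u v) = 0) ->
    jacobi_jordan m.
  move=> Bm mJ; split=> //; [move=> v|move=> u|]; [exact: represents_linearl Bm|
    exact: represents_linearr Bm|exact: represents_commutative Bm].
have symP B m : represents B m -> sym B <-> jacobi_jordan m.
  move=> Bm; have [sJ Js] := represents_sym Bm; split=> [[_ /sJ]|[_ _ _ mJ]].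
    exact: jjP Bm.
  by split; [exact: represents_linear Bm|exact: Js].
have strongP B m : represents B m ->
    strong B <-> jacobi_jordan m /\ associative m.
  move=> Bm; have mC := represents_commutative Bm.
  have [sE Es] := represents_strong Bm.
  have [EA AE] := jacobi_jordan_associativeP mC.
  split=> [[_ /sE/EA[mJ mA]]|[[_ _ _ mJ] mA]].
    by split=> //; exact: jjP Bm mJ.
  by split; [exact: represents_linear Bm|apply/Es/AE].
have productP B (m : V -> V -> V) : represents B m -> dual_product B = m.
  move=> Bm; apply: (represents_product_inj _ Bm).
  exact/linear_bracketP/(represents_linear Bm).
have inj (B B' : sym_poisson_bracket (dualspace V)) :
    linear_bracket B -> linear_bracket B' ->
    dual_product B = dual_product B' -> B = B'.
  move=> /linear_bracketP Bm /linear_bracketP B'm BB'; apply: (represents_inj Bm).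
  by rewrite BB'.
(* This gives surjectivity in both bijections: [symP] and [strongP] then transfer the condition on
   [m] to the bracket found here. *)
have ex (m : V -> V -> V) : jacobi_jordan m ->
    exists2 B, represents B m & dual_product B = m.
  by move=> [ml mr mC _]; have [B Bm] := represents_exists ml mr mC; exists B; auto.
split.
- by move=> B /linear_bracketP Bm u v; rewrite Bm.
- split=> [B /= sB|B B' /set_mem[lB _] /set_mem[lB' _]|m /= mJ].
  + by apply/(symP B) => //; case: sB => /linear_bracketP.
  + exact: inj.
  + by have [B Bm BE] := ex _ mJ; exists B => //; exact/(symP _ _ Bm).
(* The inclusion passes through products: a strong structure yields an associative Jacobi-Jordan
   product, whose Jacobi-Jordan identity gives back the symmetric Poisson condition. *)
- move=> B sB; case: (sB) => /linear_bracketP Bm _; apply/(symP _ _ Bm).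
  by have /(strongP _ _ Bm)[] := sB.
- split=> [B /= sB|B B' /set_mem[lB _] /set_mem[lB' _]|m /= mJA].
  + by apply/(strongP B) => //; case: sB => /linear_bracketP.
  + exact: inj.
  + by have [B Bm BE] := ex _ mJA.1; exists B => //; apply/(strongP _ _ Bm).
Qed.
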